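(* Let $\mathbb{K}$ be a field, let $L=\{\ell_1,\ldots,\ell_m\}$ be a collection of 2-dimensional subspaces of $\mathbb{K}^n$, let $u_k,v_k$ be a basis of $\ell_k$ for each $k\in[m]$, and let $$A_L=\sum_{k=1}^m (u_kv_k^\top-v_ku_k^\top)x_k .$$ Then $$\frac23\,{\cal Q}(A_L)\subseteq{\cal P}(A_L).$$
   Context: Notation: $[n]=\{1,\ldots,n\}$. For a matrix $A=\sum_{k=1}^m A_kx_k$ with $A_k\in\mathbb{K}^{n\times n}$ and indeterminates $x_1,\ldots,x_m$, and $I,J\subseteq[n]$, $A[I,J]$ is the submatrix with row index set $I$ and column index set $J$; the determinant of the empty matrix is $1$. For a multivariate polynomial $p$, $\operatorname{supp} p$ denotes the set of exponent vectors of monomials appearing in $p$ with nonzero coefficient. $\operatorname{Conv}$ denotes convex hull, and $\alpha{\cal P}=\{\alpha u\mid u\in{\cal P}\}$. The polytope ${\cal P}(A)\subseteq\mathbb{R}^m$ is $${\cal P}(A)=\operatorname{Conv}\bigcup_{I,J\subseteq[n]:\,|I|=|J|}\operatorname{supp}\det A[I,J],$$ where $x_1,\ldots,x_m$ are regarded as commuting variables. For $d\ge 1$ and $I,J\subseteq[n]$, the blow-up is $A[I,J]^{\{d\}}=\sum_{k=1}^m A_k[I,J]\otimes X_k$, where $X_k=(x_{k,ij})_{i,j\in[d]}$ is a $d\times d$ matrix whose entries $x_{k,ij}$ ($k\in[m]$, $i,j\in[d]$) are distinct commuting indeterminates, and $\otimes$ is the Kronecker product. For $|I|=|J|$, $\operatorname{supp}\det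 A[I,J]^{\{d\}}$ is a set of integer vectors $z=(z_{k,ij})_{k\in[m],i,j\in[d]}$. For such $z$ define $\operatorname{proj}_d(z)\in\mathbb{Q}^m_{\ge0}$ by $\operatorname{proj}_d(z)_k=\frac1d\sum_{i,j\in[d]}z_{k,ij}$. Put $${\cal S}^d_\ell=\bigcup_{I,J\subseteq[n]:\,|I|=|J|=\ell}\operatorname{proj}_d(\operatorname{supp}\det A[I,J]^{\{d\}}),\qquad {\cal Q}(A)=\operatorname{Conv}\bigcup_{d=1}^\infty\bigcup_{\ell=0}^n{\cal S}^d_\ell .$$ (Changing the basis $u_k,v_k$ of $\ell_k$ changes $u_kv_k^\top-v_ku_k^\top$ only by a nonzero scalar.) *)

(* Defs.v *)
From mathcomp Require Import all_boot all_order all_algebra.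
From mathcomp Require Import classical_sets reals.
From mathcomp Require Import mxtens.
From mathcomp Require Import mpoly.

Set Implicit Arguments.
Unset Strict Implicit.
Unset Printing Implicit Defensive.

Import Order.TTheory GRing.Theory Num.Theory.

Local Open Scope ring_scope.
Local Open Scope classical_set_scope.

Section ConvexHull.
Variables (R : realType) (m : nat).

Definition conv (S : set 'rV[R]_m) : set 'rV[R]_m :=
  [set x | exists (N : nat) (w : 'I_N -> R) (p : 'I_N -> 'rV[R]_m),
     [/\ forall i, 0 <= w i, \sum_i w i = 1, forall i, S (p i)
       & x = \sum_i w i *: p i]].

Definition dilate (a : R) (S : set 'rV[R]_m) : set 'rV[R]_m :=
  [set a *: x | x in S].

End ConvexHull.

(* The square submatrix A[I, J].  [enum_val] lists I and J increasingly; the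
   equality [e] is used only to index the columns by 'I_#|I|. *)
Definition sqsub (T : Type) (n : nat) (I J : {set 'I_n}) (e : #|I| = #|J|)
    (A : 'M[T]_n) : 'M[T]_#|I| :=
  mxsub (fun i : 'I_#|I| => enum_val i)
        (fun j : 'I_#|I| => enum_val (cast_ord e j)) A.

(* A matrix \sum_k A_k x_k is given by its family of coefficients A_k. *)
Section Polytopes.
Variables (R : realType) (K : fieldType) (m : nat).

Definition pencil (n : nat) (A : 'I_m -> 'M[K]_n) : 'M[{mpoly K[m]}]_n :=
  \sum_(k < m) 'X_k *: map_mx (@mpolyC m K) (A k).

Definition polytopeP (n : nat) (A : 'I_m -> 'M[K]_n) : set 'rV[R]_m :=
  conv [set x | exists (I J : {set 'I_n}) (e : #|I| = #|J|),
    exists2 z : 'X_{1..m}, z \in msupp (\det (sqsub e (pencil A)))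
                         & x = \row_(k < m) (z k)%:R].

(* The indeterminates x_{k,ij} are indexed by the finite type of triples
   (k, i, j), identified with an ordinal type through [enum_rank]. *)
Definition nblow (d : nat) : nat := #|{: 'I_m * 'I_d * 'I_d}|.

Definition blowvar (d : nat) (k : 'I_m) (i j : 'I_d) : 'I_(nblow d) :=
  enum_rank (k, i, j).

Definition generic_mx (d : nat) (k : 'I_m) : 'M[{mpoly K[nblow d]}]_d :=
  \matrix_(i < d, j < d) 'X_(blowvar k i j).

Definition blowup (d l : nat) (A : 'I_m -> 'M[K]_l) :
    'M[{mpoly K[nblow d]}]_(l * d) :=
  \sum_(k < m) tensmx (map_mx (@mpolyC (nblow d) K) (A k)) (generic_mx d k).

Definition proj (d : nat) (z : 'X_{1..nblow d}) : 'rV[R]_m :=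
  \row_(k < m) (d%:R^-1 * \sum_(i < d) \sum_(j < d) (z (blowvar k i j))%:R).

Definition blowup_points (n : nat) (A : 'I_m -> 'M[K]_n) (d l : nat) :
    set 'rV[R]_m :=
  [set x | exists (I J : {set 'I_n}) (e : #|I| = #|J|), #|I| = l /\
    exists2 z : 'X_{1..nblow d},
      z \in msupp (\det (blowup d (fun k => sqsub e (A k)))) & x = proj z].

Definition polytopeQ (n : nat) (A : 'I_m -> 'M[K]_n) : set 'rV[R]_m :=
  conv (\bigcup_(d in [set d : nat | (1 <= d)%N])
        \bigcup_(l in [set l : nat | (l <= n)%N]) blowup_points A d l).

End Polytopes.

Arguments polytopeP R {K m n} A.
Arguments polytopeQ R {K m n} A.

Definition line_coef (K : fieldType) (n m : nat) (u v : 'I_m -> 'cV[K]_n)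
    (k : 'I_m) : 'M[K]_n :=
  u k *m (v k)^T - v k *m (u k)^T.

(* Main.v *)
Require Import Defs.
From mathcomp Require Import all_boot all_order all_algebra.
From mathcomp Require Import classical_sets reals boolp.
From mathcomp Require Import perm mxtens mpoly.
From mathcomp Require Import zify ring lra.

Set Implicit Arguments.
Unset Strict Implicit.
Unset Printing Implicit Defensive.

Import Order.TTheory GRing.Theory Num.Theory.

Local Open Scope ring_scope.
Local Open Scope classical_set_scope.

(** Call a nonnegative vector [x] a fractional matching when, for every subspace
    [F], the sum of the [dim (ell k :&: F) * x_k] is at most [dim F], and call a
    set of planes independent when their sum is direct.  The theorem is the
    conjunction of three facts.

    - Half of every point generating [polytopeQ] is a fractional matching
      ([proj_fractional]).  In bases adapted to [F], the matrix of a plane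
      [ell k] that meets [F] vanishes outside the rows and columns that see [F]
      (outside their crossing if [ell k] lies in [F]), so giving these rows and
      columns weight 1 and the indeterminates of [ell k] weight
      [dim (ell k :&: F)] bounds the weight of each monomial of the determinant.

    - If [M] is independent, then twice its indicator vector is an exponent of a
      principal minor of the pencil ([independent_vertex]): keeping only the
      indeterminates of [M], a suitable minor of order [2 * #|M|] becomes a
      nonzero constant times the product of the squares of these indeterminates.

    - Two thirds of a fractional matching is a convex combination of indicator
      vectors of independent sets ([two_thirds_matching]).

    For the last fact it suffices to consider a vertex [x].  Its tight subspaces
    form a lattice, on which uncrossing is exact over the support of [x]; hence a
    saturated chain of tight subspaces already determines [x].  View the steps of
    the chain as nodes and a plane as an edge, incident to a step as many times as
    its intersection with the chain gains dimensions there; an edge has at most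
    two ends.  The values of the edges at a node add up to an integer, so a node
    meeting an edge with fractional value meets at least two such ends.  As there
    are at most as many fractional edges as nodes they meet, the count is exact:
    the fractional edges form a 2-regular graph, and then all have value 1/2.
    This graph has no loop, so it is 3-edge-colourable, and comparing dimensions
    step by step shows that each colour class together with the planes of value 1
    is independent ([rigid_independent]).  Averaging over the three colours gives
    1/3 on the planes of value 1/2, and weight 2/3 can be arranged on those of
    value 1. *)

(** * Convex hulls *)

Section Convexity.
Variables (R : realType) (m : nat).
Implicit Types (S : set 'rV[R]_m) (x y : 'rV[R]_m).

Lemma subset_conv S : S `<=` conv S.
Proof.
move=> x Sx; exists 1%N, (fun=> 1), (fun=> x); split => //.
- by rewrite big_ord1.
- by rewrite big_ord1 scale1r.
Qed.

Lemma conv_segment S (t : R) x y : 0 <= t <= 1 ->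
  conv S x -> conv S y -> conv S (t *: x + (1 - t) *: y).
Proof.
move=> /andP[t0 t1] [N1 [w1 [p1 [w1p w1s Sp1 ->]]]] [N2 [w2 [p2 [w2p w2s Sp2 ->]]]].
exists (N1 + N2)%N,
  (fun i => match split i with inl a => t * w1 a | inr b => (1 - t) * w2 b end),
  (fun i => match split i with inl a => p1 a | inr b => p2 b end); split.
- move=> i; case: (split i) => a; rewrite mulr_ge0 // subr_ge0 //.
- rewrite big_split_ord /= (eq_bigr (fun i => t * w1 i)); last first.
    by move=> i _; rewrite (unsplitK (inl i)).
  rewrite [X in _ + X](eq_bigr (fun i => (1 - t) * w2 i)); last first.
    by move=> i _; rewrite (unsplitK (inr i)).
  by rewrite -!mulr_sumr w1s w2s !mulr1 addrC subrK.
- by move=> i; case: (split i).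
- rewrite big_split_ord /= !scaler_sumr; congr (_ + _); apply: eq_bigr => i _.
    by rewrite (unsplitK (inl i)) scalerA.
  by rewrite (unsplitK (inr i)) scalerA.
Qed.

(** Peel off the first point and renormalise the remaining weights, which is
    possible unless the first weight is 1 and the others vanish. *)
Lemma conv_idem S : conv (conv S) `<=` conv S.
Proof.
move=> x [N [w [p [w0 w1 Sp ->]]]] {x}.
elim: N w p w0 w1 Sp => [|N IH] w p w0 w1 Sp.
  by move: w1; rewrite big_ord0 => /eqP; rewrite eq_sym oner_eq0.
rewrite big_ord_recl; move: w1; rewrite big_ord_recl => w1.
have [e|ne] := eqVneq (w ord0) 1.
  have z : \sum_(i < N) w (lift ord0 i) = 0 by lra.
  rewrite e scale1r big1 ?addr0 // => i _.
  move/eqP: z; rewrite psumr_eq0 => [/allP/(_ i)|j _]; last exact: w0.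
  by rewrite mem_index_enum => /(_ isT) /eqP ->; rewrite scale0r.
have s0 : 0 <= \sum_(i < N) w (lift ord0 i) by apply: sumr_ge0.
have lt1 : 0 < 1 - w ord0.
  by rewrite lt_neqAle eq_sym subr_eq0 eq_sym ne /=; lra.
have -> : \sum_(i < N) w (lift ord0 i) *: p (lift ord0 i) =
    (1 - w ord0) *: (\sum_(i < N) (w (lift ord0 i) / (1 - w ord0)) *: p (lift ord0 i)).
  rewrite scaler_sumr; apply: eq_bigr => i _.
  by rewrite scalerA mulrC divfK // gt_eqF.
apply: conv_segment => //; first by rewrite w0 /=; lra.
apply: IH => [i||i] //; first by rewrite divr_ge0 // ltW.
by rewrite -mulr_suml -[X in X / _](addKr (w ord0)) w1 addrC divff // gt_eqF.
Qed.

Lemma conv_min S T : S `<=` conv T -> conv S `<=` conv T.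
Proof.
move=> ST x [N [w [p [w0 w1 Sp ->]]]]; apply: conv_idem.
by exists N, w, p; split => // i; apply: ST.
Qed.

Lemma dilate_conv a S : dilate a (conv S) `<=` conv (dilate a S).
Proof.
move=> _ [x [N [w [p [w0 w1 Sp ->]]]] <-].
exists N, w, (fun i => a *: p i); split => //.
  by move=> i; exists (p i).
by rewrite scaler_sumr; apply: eq_bigr => i _; rewrite !scalerA mulrC.
Qed.

End Convexity.

(** * Vertices of polyhedra *)

Section Vertices.
Variables (R : realType) (m : nat) (T : finType).
Variables (a : T -> 'I_m -> R) (b : T -> R).
Implicit Types (x y w : 'rV[R]_m).

Definition lhs (t : T) x : R := \sum_k a t k * x 0 k.

Lemma lhsD t (c : R) x y : lhs t (x + c *: y) = lhs t x + c * lhs t y.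
Proof.
rewrite /lhs mulr_sumr -big_split; apply: eq_bigr => k _ /=; rewrite !mxE; ring.
Qed.

Definition polyhedron : set 'rV[R]_m := [set x | forall t, lhs t x <= b t].

(** The inequalities that are equalities at [x] leave no direction in which [x]
    could move both ways; this is extremality in linear-algebra form. *)
Definition vertex x : Prop := polyhedron x /\
  forall w, (forall t, lhs t x = b t -> lhs t w = 0) -> w = 0.

Definition slack x : {set T} := [set t | lhs t x != b t].

(** Ratio test: follow [w] up to the first inequality that blocks it.  Equalities
    at [x] persist because [w] is orthogonal to them, and the blocking inequality
    becomes a new one. *)
Lemma move_to_facet x w : polyhedron x ->
  (forall t, lhs t x = b t -> lhs t w = 0) -> (exists t, 0 < lhs t w) ->
  exists c : R, [/\ 0 < c, polyhedron (x + c *: w)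
                   & slack (x + c *: w) \proper slack x].
Proof.
move=> Px tw [t0 t0P].
pose ratio t := (b t - lhs t x) / lhs t w.
case: (Order.TotalTheory.arg_minP ratio (P := fun t => 0 < lhs t w) t0P) => t tP tmin.
have nt s : 0 < lhs s w -> lhs s x < b s.
  move=> sP; rewrite lt_neqAle Px andbT; apply/eqP => /tw e.
  by rewrite e ltxx in sP.
have c0 : 0 < ratio t by rewrite divr_gt0 // subr_gt0 nt.
have teq : lhs t (x + ratio t *: w) = b t.
  by rewrite lhsD /ratio divfK ?gt_eqF // addrC subrK.
exists (ratio t); split => //.
- move=> s; rewrite lhsD; have [sP|sN] := ltP 0 (lhs s w).
    by have := tmin s sP; rewrite {2}/ratio ler_pdivlMr // lerBrDl.
  apply: le_trans (Px s); rewrite gerDl mulr_ge0_le0 // ltW //.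
- apply/properP; split.
    apply/fintype.subsetP => s; rewrite !inE; apply: contra => /eqP e.
    by rewrite lhsD (tw _ e) mulr0 addr0 e.
  exists t; rewrite inE; last by rewrite teq eqxx.
  by rewrite lt_eqF // nt.
Qed.

(** A point that is not a vertex lies between two points with fewer slack
    inequalities, one on each side along a direction preserving the equalities. *)
Lemma polyhedron_conv_vertex :
  (forall w, w != 0 -> exists t, 0 < lhs t w) -> polyhedron `<=` conv vertex.
Proof.
move=> bounded x.
have [N] := ubnP #|slack x|; elim: N x => // N IH x; rewrite ltnS => leN Px.
have [[w [w0 tw]]|vx] := pselect (exists w, w != 0 /\
    forall t, lhs t x = b t -> lhs t w = 0); last first.
  apply: subset_conv; split => // w tw.
  by apply/eqP; apply: contra_notT vx => w0; exists w.
have [c [c0 Pc sc]] := move_to_facet Px tw (bounded w w0).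
have lhsN t : lhs t (- w) = - lhs t w.
  by rewrite -[- w]add0r -scaleN1r lhsD mulN1r /lhs big1 ?add0r // => k _; rewrite mxE mulr0.
have [||c' [c'0 Pc' sc']] := move_to_facet (w := - w) Px _ (bounded _ _).
- by move=> t /tw e; rewrite lhsN e oppr0.
- by rewrite oppr_eq0.
have -> : x = (c' / (c + c')) *: (x + c *: w) + (1 - c' / (c + c')) *: (x + c' *: - w).
  have cc : c + c' != 0 by rewrite gt_eqF // addr_gt0.
  by apply/rowP => k; rewrite !mxE; field.
apply: conv_segment.
- have cc : 0 < c + c' by rewrite addr_gt0.
  apply/andP; split; first by rewrite divr_ge0 ?ltW.
  by rewrite ler_pdivrMr // mul1r lerDr ltW.
- by apply: IH => //; apply: leq_trans leN; apply: proper_card.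
- by apply: IH => //; apply: leq_trans leN; apply: proper_card.
Qed.

End Vertices.

(** * Two lemmas on finite systems and graphs *)

(** Fewer equations than unknowns. *)
Lemma exists_kernel_vector (R : fieldType) (I J : finType) (E : {set I})
    (V : {set J}) (c : J -> I -> R) : (#|V| < #|E|)%N ->
  exists w : I -> R, [/\ exists k, w k != 0, forall k, k \notin E -> w k = 0
                       & forall j, j \in V -> \sum_k c j k * w k = 0].
Proof.
move=> ltVE.
pose B : 'M[R]_(#|E|, #|V|) := \matrix_(a, b) c (enum_val b) (enum_val a).
have : kermx B != 0.
  rewrite kermx_eq0 /row_free neq_ltn.
  by rewrite (leq_ltn_trans (rank_leq_col _) ltVE).
case/rowV0Pn => w /sub_kermxP wB w0.
have [a0 wa0] : exists a, w 0 a != 0.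
  apply/existsP; apply: contra_neqT w0; rewrite negb_exists => /forallP w0.
  by apply/rowP => a; rewrite mxE; apply/eqP; have := w0 a; rewrite negbK.
pose ext k := \sum_(a | enum_val a == k) w 0 a.
have extE a : ext (enum_val a) = w 0 a.
  by rewrite /ext (eq_bigl (pred1 a)) ?big_pred1_eq // => a' /=; rewrite (inj_eq enum_val_inj).
exists ext; split.
- by exists (enum_val a0); rewrite extE.
- move=> k kE; rewrite /ext big_pred0 // => a; apply/eqP => e.
  by rewrite -e enum_valP in kE.
- move=> j jV; rewrite (bigID (mem E)) /= [X in _ + X]big1 ?addr0; last first.
    move=> k kE; rewrite /ext big_pred0 ?mulr0 // => a; apply/eqP => e.
    by rewrite -e enum_valP in kE.
  rewrite big_enum_val /=.
  have := congr1 (fun M : 'rV_#|V| => M 0 (enum_rank_in jV j)) wB; rewrite !mxE => {2}<-.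
  by apply: eq_bigr => a _; rewrite extE mxE enum_rankK_in // mulrC.
Qed.

(** Remove a vertex and colour the rest: its at most two neighbours leave a third
    colour free. *)
Lemma greedy_3coloring (I : finType) (e : rel I) (E : {set I}) :
  (forall j k, e j k = e k j) ->
  (forall k, k \in E -> (#|[pred j in E | (j != k) && e k j]| <= 2)%N) ->
  exists col : I -> 'I_3,
    {in E &, forall j k, j != k -> e j k -> col j != col k}.
Proof.
move=> esym; have [N] := ubnP #|E|; elim: N E => // N IH E leN deg.
have [->|[k kE]] := set_0Vmem E.
  by exists (fun=> ord0) => j k; rewrite inE.
have [||col colP] := IH (E :\ k)%SET.
- by move: leN; rewrite (cardsD1 k) kE.
- move=> j; rewrite !inE => /andP[_ jE]; apply: leq_trans (deg j jE).
  apply: subset_leq_card; apply/fintype.subsetP => l; rewrite !inE.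
  by case/andP => /andP[_ ->].
pose N2 := [pred j in E | (j != k) && e k j].
have [c cN] : exists c, c \notin [seq col j | j in N2].
  apply/existsP; rewrite -negb_forall; apply/negP => /forallP full.
  have : (#|'I_3| <= size [seq col j | j in N2])%N.
    apply: leq_trans (card_size _); apply: subset_leq_card.
    by apply/fintype.subsetP => c _.
  by rewrite size_map -cardE card_ord leqNgt ltnS deg.
exists (fun j => if j == k then c else col j) => i j iE jE ij eij.
have [ik|ik] := eqVneq i k; have [jk|jk] := eqVneq j k.
- by rewrite ik jk eqxx in ij.
- apply: contraNneq cN => ->; apply/fintype.imageP; exists j => //.
  by rewrite inE jE jk -ik eij.
- apply: contraNneq cN => <-; apply/fintype.imageP; exists i => //.
  by rewrite inE iE ik -jk esym eij.
- by apply: colP => //; rewrite !inE ?ik ?jk.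
Qed.

(** * The polytope of fractional matchings *)

Section FractionalMatching.
Variables (R : realType) (K : fieldType) (vT : vectType K) (m : nat).
Variables (ell : 'I_m -> {vspace vT}) (dim_ell : forall k, \dim (ell k) = 2%N).
Implicit Types (F G H : {vspace vT}) (x y w : 'rV[R]_m).

Definition meet_dim F k : nat := \dim (ell k :&: F).

Lemma meet_dim_le2 F k : (meet_dim F k <= 2)%N.
Proof. by rewrite -(dim_ell k) dimvS // capvSl. Qed.

Lemma meet_dim_mono F G k : (F <= G)%VS -> (meet_dim F k <= meet_dim G k)%N.
Proof. by move=> FG; rewrite dimvS // capvS. Qed.

Lemma meet_dim_sub F k : (ell k <= F)%VS -> meet_dim F k = 2%N.
Proof. by move=> /capv_idPl; rewrite /meet_dim => ->. Qed.

Lemma meet_dim0 k : meet_dim 0%VS k = 0%N.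
Proof. by rewrite /meet_dim capv0 dimv0. Qed.

(** The source of all uncrossing: the sum of two intersections with [ell k] is
    contained in the intersection with the sum, and may be smaller. *)
Lemma meet_dim_supermod F G k :
  (meet_dim F k + meet_dim G k <= meet_dim (F + G)%VS k + meet_dim (F :&: G)%VS k)%N.
Proof.
rewrite /meet_dim -dimv_sum_cap leq_add // dimvS //.
  by rewrite subv_add !capvS ?addvSl ?addvSr.
have lF := capvSl (ell k :&: F) (ell k :&: G).
have lG := capvSr (ell k :&: F) (ell k :&: G).
by rewrite !subv_cap (subv_trans lF) ?(subv_trans lF (capvSr _ _)) ?capvSl
  ?(subv_trans lG (capvSr _ _)).
Qed.

Definition load F (x : 'rV[R]_m) : R := \sum_k (meet_dim F k)%:R * x 0 k.

Definition fractional_matching : set 'rV[R]_m :=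
  [set x : 'rV[R]_m | (forall k, 0 <= x 0 k) /\ forall F, load F x <= (\dim F)%:R].

Definition tight x F : Prop := load F x = (\dim F)%:R.

(** Extremality of [x] in the fractional matching polytope: only the constraints
    [0 <= x_k] and those of the tight subspaces can be equalities. *)
Definition rigid (x : 'rV[R]_m) : Prop := forall w : 'rV[R]_m,
  (forall k, x 0 k = 0 -> w 0 k = 0) -> (forall F, tight x F -> load F w = 0) ->
  w = 0.

(** Over an infinite field there are infinitely many subspaces, but the inequality
    of [F] depends only on the numbers [dim (ell k :&: F)] and [dim F].  So the
    inequalities are indexed by the finite type of all such data, and data that
    no subspace realizes stand for the inequality [0 <= 0]. *)
Section Encoding.

Let T : finType := ({ffun 'I_m -> 'I_3} * 'I_(dim vT).+1 + 'I_m)%type.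

Let realized (t : {ffun 'I_m -> 'I_3} * 'I_(dim vT).+1) : bool :=
  `[< exists F, (forall k, meet_dim F k = t.1 k) /\ \dim F = t.2 >].

Let a (t : T) (k : 'I_m) : R :=
  match t with
  | inl t => if realized t then (t.1 k)%:R else 0
  | inr j => - (k == j)%:R
  end.

Let b (t : T) : R :=
  match t with inl t => if realized t then (t.2 : nat)%:R else 0 | inr _ => 0 end.

Let code F : {ffun 'I_m -> 'I_3} * 'I_(dim vT).+1 :=
  ([ffun k => inord (meet_dim F k)], inord (\dim F)).

Let code1 F k : (code F).1 k = meet_dim F k :> nat.
Proof. by rewrite ffunE inordK // ltnS meet_dim_le2. Qed.

Let code2 F : (code F).2 = \dim F :> nat.
Proof. by rewrite inordK // ltnS -dimvf dimvS // subvf. Qed.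

Let realized_code F : realized (code F).
Proof. by apply/asboolP; exists F; split => [k|]; rewrite ?code1 ?code2. Qed.

Let lhs_code F x : lhs a (inl (code F)) x = load F x.
Proof.
by apply: eq_bigr => k _; rewrite /a realized_code code1.
Qed.

Let lhs_inr k x : lhs a (inr k) x = - x 0 k.
Proof.
rewrite /lhs (bigD1 k) //= eqxx mulN1r big1 ?addr0 // => j /negbTE jk.
by rewrite jk oppr0 mul0r.
Qed.

Let lhs_realized t x : realized t ->
  exists2 F, lhs a (inl t) x = load F x & (\dim F)%:R = b (inl t).
Proof.
move=> rt; have /asboolP[F [F1 F2]] := rt; exists F; last by rewrite /b rt F2.
by apply: eq_bigr => k _; rewrite /a rt F1.
Qed.

Let lhs_unrealized t x : ~~ realized t -> lhs a (inl t) x = 0 /\ b (inl t) = 0.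
Proof.
move=> /negbTE rt; rewrite /b /lhs /a rt; split=> //.
by rewrite big1 // => k _; rewrite mul0r.
Qed.

Let fm_polyhedron x : fractional_matching x <-> polyhedron a b x.
Proof.
split=> [[x0 xF] [t|k]|Px].
- have [rt|rt] := boolP (realized t).
    by have [F -> <-] := lhs_realized x rt.
  by have [-> ->] := lhs_unrealized x rt.
- by rewrite lhs_inr oppr_le0.
- split=> [k|F]; first by have := Px (inr k); rewrite lhs_inr oppr_le0.
  by have := Px (inl (code F)); rewrite lhs_code /b realized_code code2.
Qed.

(** The polytope is bounded: a direction with a negative coordinate is blocked by
    nonnegativity, and any other by the inequality of the full space. *)
Lemma fractional_matching_rigid :
  fractional_matching `<=` conv [set x | fractional_matching x /\ rigid x].
Proof.
move=> x /fm_polyhedron Px.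
have bounded w : w != 0 -> exists t, 0 < lhs a t w.
  move=> w0; have [[k wk]|wp] := pselect (exists k, w 0 k < 0).
    by exists (inr k); rewrite lhs_inr oppr_gt0.
  have {}wp k : 0 <= w 0 k by rewrite leNgt; apply/negP => wk; apply: wp; exists k.
  exists (inl (code fullv)); rewrite lhs_code /load.
  have t0 k : 0 <= (meet_dim fullv k)%:R * w 0 k by rewrite mulr_ge0.
  rewrite lt_neqAle sumr_ge0 ?andbT //; apply: contra w0.
  rewrite eq_sym psumr_eq0 => [/allP h|//]; apply/eqP/rowP => k; rewrite mxE.
  have := h k; rewrite mem_index_enum meet_dim_sub ?subvf // => /(_ isT).
  by rewrite mulf_eq0 pnatr_eq0 /= => /eqP.
apply: conv_min (polyhedron_conv_vertex bounded Px).
move=> y [/fm_polyhedron Py vy]; apply: subset_conv; split => // w w0 wF.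
apply: vy => -[t|k].
- have [rt|rt] := boolP (realized t); last by have [->] := lhs_unrealized w rt.
  have /asboolP[F [F1 F2]] := rt.
  have e z : lhs a (inl t) z = load F z.
    by apply: eq_bigr => k _; rewrite /a rt F1.
  rewrite !e /b rt -F2; exact: wF.
- by rewrite !lhs_inr => /eqP; rewrite oppr_eq0 => /eqP /w0 ->; rewrite oppr0.
Qed.

End Encoding.

(** Adding the inequalities of [F + G] and [F :&: G] and comparing with the two
    equalities forces equality everywhere, hence also in supermodularity for each
    plane of the support. *)
Lemma tight_uncross x F G : fractional_matching x -> tight x F -> tight x G ->
  [/\ tight x (F + G)%VS, tight x (F :&: G)%VS &
      forall w, (forall k, x 0 k = 0 -> w 0 k = 0) ->
        load F w + load G w = load (F + G)%VS w + load (F :&: G)%VS w].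
Proof.
move=> [x0 xF] tF tG.
have gap0 k : 0 <= ((meet_dim (F + G)%VS k)%:R + (meet_dim (F :&: G)%VS k)%:R
                   - ((meet_dim F k)%:R + (meet_dim G k)%:R)) * x 0 k.
  by rewrite mulr_ge0 // subr_ge0 -!natrD ler_nat meet_dim_supermod.
have gapE w : \sum_k ((meet_dim (F + G)%VS k)%:R + (meet_dim (F :&: G)%VS k)%:R
                   - ((meet_dim F k)%:R + (meet_dim G k)%:R)) * w 0 k
   = load (F + G)%VS w + load (F :&: G)%VS w - (load F w + load G w).
  rewrite /load -!big_split -sumrN -big_split; apply: eq_bigr => k _ /=; ring.
have ge0 := sumr_ge0 (index_enum _) (fun k (_ : true) => gap0 k).
rewrite gapE in ge0.
have leS := xF (F + G)%VS; have leI := xF (F :&: G)%VS.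
have dS : (\dim (F + G))%:R + (\dim (F :&: G))%:R = (\dim F)%:R + (\dim G)%:R :> R.
  by rewrite -!natrD dimv_sum_cap.
rewrite /tight in tF tG *.
have gz : \sum_k ((meet_dim (F + G)%VS k)%:R + (meet_dim (F :&: G)%VS k)%:R
                   - ((meet_dim F k)%:R + (meet_dim G k)%:R)) * x 0 k = 0.
  by rewrite gapE; lra.
split; [lra|lra|] => w w0; apply/eqP; rewrite -subr_eq0 -opprB -gapE oppr_eq0.
apply/eqP; rewrite big1 // => k _.
have /eqP := gz; rewrite psumr_eq0 => [/allP/(_ k)|//].
rewrite mem_index_enum => /(_ isT); rewrite mulf_eq0 => /orP[/eqP->|/eqP xk].
  by rewrite mul0r.
by rewrite (w0 _ xk) mulr0.
Qed.

Lemma load0 x : load 0%VS x = 0.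
Proof. by rewrite /load big1 // => k _; rewrite meet_dim0 mul0r. Qed.

Lemma tight0 x : tight x 0%VS.
Proof. by rewrite /tight load0 dimv0. Qed.

(** A minimal tight subspace properly above [F], or [F] itself if there is none;
    in the latter case [F] contains every tight subspace, since the sum with it
    is tight. *)
Lemma tight_step x F : fractional_matching x -> tight x F ->
  exists G, [/\ tight x G, (F <= G)%VS,
    forall H, tight x H -> (F <= H <= G)%VS -> H = F \/ H = G
  & G = F -> forall H, tight x H -> (H <= F)%VS].
Proof.
move=> fx tF.
pose P d := `[< exists G, [/\ tight x G, (F <= G)%VS, F <> G & \dim G = d] >].
have [exP|nP] := pselect (exists d, P d).
- have [d /asboolP[G [tG FG nFG dG]] Gmin] := ex_minnP exP.
  exists G; split => // [H tH /andP[FH HG]|e]; last by case: nFG.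
  have [->|/eqP nFH] := eqVneq F H; first by left.
  right; apply/eqP; rewrite eqEdim HG dG Gmin //.
  by apply/asboolP; exists H.
- have top H : tight x H -> (H <= F)%VS.
    move=> tH; have [tS _ _] := tight_uncross fx tF tH.
    have [e|/eqP ne] := eqVneq F (F + H)%VS; first by rewrite e addvSr.
    case: nP; exists (\dim (F + H)); apply/asboolP; exists (F + H)%VS.
    by split => //; rewrite addvSl.
  exists F; split => // H tH /andP[FH HF]; left; apply/eqP.
  by rewrite eqEsubv HF.
Qed.

(** Consecutive members may coincide, so that the chain can be a function on all
    of [nat] that stalls at the largest tight subspace. *)
Definition saturated_chain x (F : nat -> {vspace vT}) (r : nat) : Prop :=
  [/\ F 0%N = 0%VS, forall i, tight x (F i), forall i, (F i <= F i.+1)%VS,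
      forall i H, tight x H -> (F i <= H <= F i.+1)%VS -> H = F i \/ H = F i.+1
    & forall H, tight x H -> (H <= F r)%VS].

(** Each step raises the dimension until the top is reached, so one more step than
    the dimension of the space is enough. *)
Lemma saturated_chain_exists x : fractional_matching x ->
  exists (C : nat -> {vspace vT}) r, saturated_chain x C r.
Proof.
move=> fx.
pose stepP (F G : {vspace vT}) := tight x F -> [/\ tight x G, (F <= G)%VS,
    forall H, tight x H -> (F <= H <= G)%VS -> H = F \/ H = G
  & G = F -> forall H, tight x H -> (H <= F)%VS].
have /choice[next nextP] : forall F, exists G, stepP F G.
  move=> F.
  have [tF|ntF] := pselect (tight x F); last by exists F.
  by have [G ?] := tight_step fx tF; exists G.
pose F i := iter i next 0%VS.
have tF i : tight x (F i).
  elim: i => [|i IH]; first exact: tight0.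
  by have [] := nextP _ IH.
have FP i : [/\ tight x (F i.+1), (F i <= F i.+1)%VS,
    forall H, tight x H -> (F i <= H <= F i.+1)%VS -> H = F i \/ H = F i.+1
  & F i.+1 = F i -> forall H, tight x H -> (H <= F i)%VS].
  exact: nextP (tF i).
exists F, (dim vT).+1; split => // [i|i H|].
- by have [] := FP i.
- by have [_ _ + _] := FP i; apply.
have grow i : (i <= \dim (F i))%N \/ forall H, tight x H -> (H <= F i)%VS.
  elim: i => [|i [IH|IH]]; first by left.
  - have [_ Fi _ top] := FP i.
    have [e|/eqP ne] := eqVneq (F i.+1) (F i).
      by right; rewrite e; apply: top.
    left; apply: leq_ltn_trans IH _; rewrite ltnNge; apply/negP => le.
    by apply: ne; apply/eqP; rewrite eq_sym eqEdim Fi.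
  - by right => H /IH; have [_ Fi _ _] := FP i => /subv_trans; apply.
have [le|//] := grow (dim vT).+1.
by have := leq_trans le (dimvS (subvf (F (dim vT).+1))); rewrite dimvf ltnn.
Qed.

(** The number of ends of the edge [k] at the node [i]. *)
Definition gain (F : nat -> {vspace vT}) (i : nat) (k : 'I_m) : nat :=
  (meet_dim (F i.+1) k - meet_dim (F i) k)%N.

(** A saturated chain spans all tight constraints.  Given a tight [G], the subspace
    [(G :&: F i.+1) + F i] is tight and lies between two consecutive members of
    the chain, hence is one of them; by uncrossing, the load of [w] on
    [G :&: F i] does not depend on [i]. *)
Lemma chain_rigid x (F : nat -> {vspace vT}) r w : fractional_matching x -> rigid x ->
  saturated_chain x F r ->
  (forall k, x 0 k = 0 -> w 0 k = 0) ->
  (forall i, (i < r)%N -> \sum_k (gain F i k)%:R * w 0 k = 0) -> w = 0.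
Proof.
move=> fx rx [F0 tF Fmono Fgap Ftop] w0 wF.
have wFi i : (i <= r)%N -> load (F i) w = 0.
  elim: i => [|i IH] ir; first by rewrite F0 load0.
  have -> : load (F i.+1) w = load (F i) w + \sum_k (gain F i k)%:R * w 0 k.
    rewrite /load -big_split; apply: eq_bigr => k _ /=.
    by rewrite -mulrDl -natrD subnKC // meet_dim_mono.
  by rewrite (IH (ltnW ir)) (wF i ir) addr0.
apply: rx => // G tG.
have {Ftop}/capv_idPl <- := Ftop G tG.
have tI i : tight x (G :&: F i)%VS by have [] := tight_uncross fx tG (tF i).
suff: forall i, (i <= r)%N -> load (G :&: F i)%VS w = 0 by apply.
elim=> [|i IH] ir; first by rewrite F0 capv0 load0.
have [tS _ /(_ w w0)] := tight_uncross fx (tI i.+1) (tF i).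
have -> : (G :&: F i.+1 :&: F i = G :&: F i)%VS.
  by rewrite -capvA; congr (_ :&: _)%VS; apply/capv_idPr.
rewrite (wFi _ (ltnW ir)) (IH (ltnW ir)) !addr0.
have [|->|->] := Fgap i _ tS; last by rewrite wFi.
  by rewrite addvSr subv_add capvSr Fmono.
by rewrite (wFi _ (ltnW ir)).
Qed.

Definition independent_planes (M : {set 'I_m}) : Prop :=
  \dim (\sum_(k in M) ell k) = (#|M| + #|M|)%N.

(** * Planes with fractional value at a rigid point *)

Section RigidPoint.
Variables (x : 'rV[R]_m) (C : nat -> {vspace vT}) (r : nat).
Hypotheses (fx : fractional_matching x) (rx : rigid x).
Hypothesis (sC : saturated_chain x C r).

Let ones : {set 'I_m} := finset (fun k => x 0 k == 1).
Let fracs : {set 'I_m} := finset (fun k => 0 < x 0 k < 1).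

Let x_ge0 k : 0 <= x 0 k. Proof. by case: fx. Qed.

Let x_le1 k : x 0 k <= 1.
Proof.
have [_ /(_ (ell k))] := fx; rewrite /load dim_ell (bigD1 k) //= meet_dim_sub ?subvv //.
have : 0 <= \sum_(j | j != k) (meet_dim (ell k) j)%:R * x 0 j.
  by apply: sumr_ge0 => j _; rewrite mulr_ge0.
lra.
Qed.

Let split_sum (c : 'I_m -> R) : \sum_k c k * x 0 k =
  \sum_(k in ones) c k + \sum_(k in fracs) c k * x 0 k.
Proof.
rewrite (bigID (mem ones)) /=; congr (_ + _).
  by apply: eq_bigr => k; rewrite inE => /eqP ->; rewrite mulr1.
rewrite (bigID (mem fracs)) /= [X in _ + X]big1 ?addr0.
  apply: eq_bigl => k; rewrite !inE [x 0 k < 1]lt_neqAle x_le1 andbT.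
  by case: (x 0 k != 1); rewrite ?andbF.
move=> k; rewrite !inE => /andP[n1]; have := x_le1 k; have := x_ge0 k.
rewrite !le_eqVlt (negbTE n1) /= => /orP[/eqP <-|->]; first by rewrite mulr0.
by move=> ->.
Qed.

Let chain_tight i : tight x (C i). Proof. by case: sC. Qed.
Let chain_mono i : (C i <= C i.+1)%VS. Proof. by case: sC. Qed.
Let chain0 : C 0%N = 0%VS. Proof. by case: sC. Qed.

Let gain_load i : \sum_k (gain C i k)%:R * x 0 k = (\dim (C i.+1) - \dim (C i))%N%:R.
Proof.
rewrite natrB ?dimvS // -(chain_tight i) -(chain_tight i.+1) /load -sumrB.
by apply: eq_bigr => k _; rewrite natrB ?meet_dim_mono // mulrBl.
Qed.

(** Degree of the node [i] in the graph of edges with fractional value. *)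
Let deg i : nat := (\sum_(k in fracs) gain C i k)%N.

(** The values of all edges at the node add up to a difference of dimensions, and
    the edges of value 1 contribute an integer to it. *)
Let frac_load i : exists n : nat,
  \sum_(k in fracs) (gain C i k)%:R * x 0 k = n%:R
  /\ (\dim (C i.+1) = \dim (C i) + \sum_(k in ones) gain C i k + n)%N.
Proof.
have := gain_load i; rewrite (split_sum (fun k => (gain C i k)%:R)) -natr_sum.
set s := (\sum_(k in ones) _)%N; set f := (X in _ + X = _) => e.
have f0 : 0 <= f by apply: sumr_ge0 => k _; rewrite mulr_ge0.
have le : (s <= \dim (C i.+1) - \dim (C i))%N.
  by rewrite -(ler_nat R) -e lerDl.
exists (\dim (C i.+1) - \dim (C i) - s)%N; split.
  by rewrite natrB // -e addrC addKr.
by rewrite -addnA subnKC // subnKC // dimvS.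
Qed.

(** Replacing each value, which lies strictly between 0 and 1, by 0 or by 1 gives
    strict bounds. *)
Let deg_gt0 i n : (0 < deg i)%N ->
  \sum_(k in fracs) (gain C i k)%:R * x 0 k = n%:R -> (0 < n < deg i)%N.
Proof.
rewrite lt0n sum_nat_eq0 => /forallPn [k]; rewrite negb_imply -lt0n => /andP[kE gk] e.
have := kE; rewrite inE => /andP[xk0 xk1].
have g0 : 0 < (gain C i k)%:R :> R by rewrite ltr0n.
have pos (f : 'I_m -> R) : (forall j, 0 <= f j) -> 0 < f k ->
    0 < \sum_(j in fracs) (gain C i j)%:R * f j.
  move=> f0 fk; rewrite (bigD1 k) //= ltr_wpDr ?mulr_gt0 //.
  by apply: sumr_ge0 => j _; rewrite mulr_ge0.
rewrite -!(ltr_nat R) -e pos //= /deg natr_sum -subr_gt0 -sumrB.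
have := pos (fun j => 1 - x 0 j); rewrite subr_gt0 => /(_ _ xk1).
rewrite (eq_bigr (fun j => (gain C i j)%:R - (gain C i j)%:R * x 0 j)).
  by apply=> j; rewrite subr_ge0.
by move=> j _; rewrite mulrBr mulr1.
Qed.

Let touched : {set 'I_r} := finset (fun i : 'I_r => (0 < deg i)%N).

Let deg_ge2 i : (0 < deg i)%N -> (2 <= deg i)%N.
Proof.
by move=> d0; have [n [e _]] := frac_load i; have := deg_gt0 d0 e; lia.
Qed.

(** Otherwise some nonzero vector supported on the fractional edges would be
    orthogonal to the whole chain, against rigidity. *)
Let card_fracs : (#|fracs| <= #|touched|)%N.
Proof.
rewrite leqNgt; apply/negP => lt.
have [w [[k wk] w0 wV]] :=
  exists_kernel_vector (fun (i : 'I_r) k => (gain C i k)%:R : R) lt.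
suff /rowP/(_ k) : \row_j w j = 0 by rewrite !mxE => /eqP; rewrite (negbTE wk).
apply: (chain_rigid fx rx sC) => [j xj|i ir]; rewrite ?mxE.
  by apply: w0; rewrite inE xj ltxx.
rewrite (eq_bigr (fun j => (gain C i j)%:R * w j)); last by move=> j _; rewrite mxE.
have [iV|iV] := boolP (Ordinal ir \in touched); first exact: wV iV.
move: iV; rewrite inE -leqNgt leqn0 sum_nat_eq0 => /forallP /= g0.
apply: big1 => j _; have [jE|jE] := boolP (j \in fracs).
  by have := g0 j; rewrite jE => /eqP ->; rewrite mul0r.
by rewrite w0 // mulr0.
Qed.

Let sum_gain k j : (\sum_(i < j) gain C i k)%N = meet_dim (C j) k.
Proof.
elim: j => [|j IH]; first by rewrite big_ord0 chain0 meet_dim0.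
by rewrite big_ord_recr /= IH subnKC // meet_dim_mono.
Qed.

Let sum_deg : (\sum_(i in touched) deg i = \sum_(k in fracs) meet_dim (C r) k)%N.
Proof.
transitivity (\sum_(i < r) deg i)%N.
  rewrite [RHS](bigID (mem touched)) /= [X in (_ + X)%N]big1 ?addn0 // => i.
  by rewrite inE -leqNgt leqn0 => /eqP.
by rewrite exchange_big /=; apply: eq_bigr => k _; rewrite sum_gain.
Qed.

(** Double counting of the ends of fractional edges; with [card_fracs] and
    [sum_deg] all these inequalities are equalities. *)
Let counting : (2 * #|touched| <= \sum_(i in touched) deg i)%N
  /\ (\sum_(k in fracs) meet_dim (C r) k <= 2 * #|fracs|)%N.
Proof.
rewrite ![(2 * _)%N]mulnC -!sum_nat_const; split; apply: leq_sum => i.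
  by rewrite inE; apply: deg_ge2.
by rewrite meet_dim_le2.
Qed.

Let deg2 (i : 'I_r) : (0 < deg i)%N -> deg i = 2%N.
Proof.
move=> di; apply/eqP; rewrite eqn_leq deg_ge2 // andbT leqNgt; apply/negP => d3.
have iV : i \in touched by rewrite inE.
have [c1 c2] := counting; have c3 := card_fracs.
have : (2 * #|touched| < \sum_(i in touched) deg i)%N.
  rewrite (cardsD1 i) iV (bigD1 i) //= mulnDr.
  have : (2 * #|(touched :\ i)%SET| <= \sum_(j in touched | j != i) deg j)%N.
    rewrite mulnC -sum_nat_const (eq_bigl (fun j => (j \in touched) && (j != i))).
      by apply: leq_sum => j /andP[]; rewrite inE => /deg_ge2.
    by move=> j; rewrite in_setD1 andbC.
  exact: leq_add d3.
by move: sum_deg; lia.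
Qed.

Let frac_in_top k : k \in fracs -> meet_dim (C r) k = 2%N.
Proof.
move=> kE; apply/eqP; rewrite eqn_leq meet_dim_le2 /= leqNgt; apply/negP => d1.
have [c1 c2] := counting; have c3 := card_fracs.
have : (\sum_(j in fracs) meet_dim (C r) j < 2 * #|fracs|)%N.
  rewrite (cardsD1 k) kE (bigD1 k) //= mulnDr.
  have : (\sum_(j in fracs | j != k) meet_dim (C r) j <= 2 * #|(fracs :\ k)%SET|)%N.
    rewrite mulnC -sum_nat_const [leqRHS](eq_bigl (fun j => (j \in fracs) && (j != k))).
      by apply: leq_sum => j _; rewrite meet_dim_le2.
    by move=> j; rewrite in_setD1 andbC.
  exact: leq_add d1.
by move: sum_deg; lia.
Qed.

(** All nodes having degree 2 or 0, the value 1/2 solves the same equations along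
    the chain, and the solution is unique. *)
Let frac_half k : k \in fracs -> x 0 k = 1 / 2.
Proof.
pose w : 'rV[R]_m := \row_j (if j \in fracs then x 0 j - 1 / 2 else 0).
have : w = 0.
  apply: (chain_rigid fx rx sC) => [j xj|i ir]; rewrite ?mxE.
    by rewrite inE xj ltxx.
  transitivity (\sum_(j in fracs) ((gain C i j)%:R * x 0 j - (gain C i j)%:R / 2)).
    rewrite [LHS](bigID (mem fracs)) /= [X in _ + X]big1 ?addr0 => [|j /negbTE jE].
      by apply: eq_bigr => j jE; rewrite mxE jE mulrBr mul1r.
    by rewrite mxE jE mulr0.
  rewrite sumrB -mulr_suml -natr_sum -/(deg i).
  have [d0|d0] := posnP (deg i).
    rewrite d0 mul0r subr0; apply: big1 => j jE.
    move/eqP: d0; rewrite sum_nat_eq0 => /forallP/(_ j).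
    by rewrite jE => /eqP ->; rewrite mul0r.
  have [n [e _]] := frac_load i; have := deg_gt0 d0 e.
  rewrite e (deg2 (i := Ordinal ir) d0); case: n {e} => [|[|n]] // _.
  by lra.
by move=> /rowP/(_ k) + kE; rewrite !mxE kE => /eqP; rewrite subr_eq0 => /eqP.
Qed.

Let x_lower k : k \in (ones :|: fracs)%SET -> 1 - (k \in fracs)%:R / 2 <= x 0 k.
Proof.
rewrite finset.in_setU; have [kE _|_] := boolP (k \in fracs).
  by rewrite frac_half //= ; lra.
by rewrite orbF inE => /eqP -> /=; lra.
Qed.

(** The inequality of [H] minus the equality of [F].  Planes of [M] are estimated
    through what they have in [G], which [H] contains; the other planes are kept
    exactly for the sake of [no_loop]. *)
Let load_collect F G H (M : {set 'I_m}) : (M \subset ones :|: fracs)%SET ->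
  tight x F -> (F <= G)%VS -> (F <= H)%VS ->
  (forall k, k \in M -> (ell k :&: G <= H)%VS) ->
  \sum_(k in M) (meet_dim G k - meet_dim F k)%N%:R * (1 - (k \in fracs)%:R / 2)
    + \sum_(k | k \notin M) (meet_dim H k - meet_dim F k)%N%:R * x 0 k
  <= (\dim H)%:R - (\dim F)%:R :> R.
Proof.
move=> sM tF FG FH sH.
have [_ /(_ H) leH] := fx.
apply: le_trans (lerB leH (lexx _)); rewrite -tF /load -sumrB.
rewrite [leRHS](bigID (mem M)) /= lerD //; apply: ler_sum => k kM.
  rewrite -mulrBl -natrB ?meet_dim_mono // ler_pM ?ler_nat //.
  - by case: (k \in fracs) => /=; lra.
  - by rewrite leq_sub2r // dimvS // subv_cap capvSl sH.
  - by apply: x_lower; apply: (fintype.subsetP sM).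
by rewrite -mulrBl -natrB ?meet_dim_mono.
Qed.

(** The load leaves a defect of at most 1/2 when the fractional planes of [M] gain
    at most one dimension, and dimensions are integers. *)
Let independent_step F G (M : {set 'I_m}) : (M \subset ones :|: fracs)%SET ->
  tight x F -> (F <= G)%VS ->
  (\sum_(k in M | k \in fracs) (meet_dim G k - meet_dim F k) <= 1)%N ->
  (\dim F + \sum_(k in M) (meet_dim G k - meet_dim F k)
     <= \dim (F + \sum_(k in M) (ell k :&: G)))%N.
Proof.
move=> sM tF FG frac1; set H := (F + _)%VS.
have FH : (F <= H)%VS by rewrite addvSl.
have sH k : k \in M -> (ell k :&: G <= H)%VS.
  by move=> kM; apply: subv_trans (addvSr _ _); apply: (sumv_sup k).
have := load_collect sM tF FG FH sH.
have : 0 <= \sum_(k | k \notin M) (meet_dim H k - meet_dim F k)%N%:R * x 0 k.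
  by apply: sumr_ge0 => k _; rewrite mulr_ge0.
have -> : \sum_(k in M) (meet_dim G k - meet_dim F k)%N%:R * (1 - (k \in fracs)%:R / 2)
  = (\sum_(k in M) (meet_dim G k - meet_dim F k))%N%:R
   - (\sum_(k in M | k \in fracs) (meet_dim G k - meet_dim F k))%N%:R / 2 :> R.
  rewrite !natr_sum mulr_suml big_mkcondr -sumrB; apply: eq_bigr => k _ /=.
  by case: (k \in fracs) => /=; lra.
move: (\sum_(k in M) _)%N => N; rewrite -(ler_nat R) in frac1.
rewrite leqNgt -(ler_nat R (\dim H).+1) -[(\dim H).+1]addn1 !natrD => h0 h1.
by apply/negP => h2; lra.
Qed.

Let dim_collect F G (M : {set 'I_m}) : (F <= G)%VS ->
  (\dim (F + \sum_(k in M) (ell k :&: G))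
    <= \dim F + \sum_(k in M) (meet_dim G k - meet_dim F k))%N.
Proof.
move=> FG; elim/big_rec2: _ => [|k n U _ IH]; first by rewrite addv0 addn0.
rewrite addvA [(F + _)%VS]addvC -addvA.
have := dimv_sum_cap (ell k :&: G) (F + U).
have : (meet_dim F k <= \dim (ell k :&: G :&: (F + U)))%N.
  rewrite dimvS // !subv_cap capvSl (subv_trans (capvSr _ _) FG) /=.
  by rewrite (subv_trans (capvSr _ _)) ?addvSl.
rewrite -/(meet_dim G k); have := meet_dim_mono k FG; lia.
Qed.

(** A loop at a node would have both ends in a quotient of dimension one more than
    the total gain of the planes of value 1.  The span [H] of the latter is a
    hyperplane in this quotient, so it meets the loop, whose value 1/2 then overloads [H]. *)
Let no_loop (i : 'I_r) k : k \in fracs -> (gain C i k <= 1)%N.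
Proof.
move=> kE; rewrite leqNgt; apply/negP => g2.
have FG := chain_mono i; have tF := chain_tight i.
have di : (0 < deg i)%N.
  by rewrite /deg (bigD1 k) //=; apply: ltn_addr; apply: ltnW.
have [n [e dG]] := frac_load i.
have {e} n1 : n = 1%N by have := deg_gt0 di e; rewrite deg2 //; lia.
have sM : (ones \subset ones :|: fracs)%SET by apply: finset.subsetUl.
have dis j : j \in ones -> j \notin fracs.
  by rewrite !inE => /eqP ->; rewrite ltxx andbF.
have lo := @independent_step (C i) (C i.+1) ones sM tF FG.
rewrite big1 ?leqn0 // in lo; last by move=> j /andP[/dis/negbTE ->].
have {lo}lo := lo isT.
have up := dim_collect ones FG.
set H := (_ + _)%VS in lo up.
have sH j : j \in ones -> (ell j :&: C i.+1 <= H)%VS.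
  by move=> jM; apply: subv_trans (addvSr _ _); apply: (sumv_sup j).
have FH : (C i <= H)%VS by rewrite addvSl.
have HG : (H <= C i.+1)%VS.
  by rewrite subv_add FG; apply/subv_sumP => j _; rewrite capvSr.
have := load_collect sM tF FG FH sH.
have hk : (1 <= meet_dim H k - meet_dim (C i) k)%N.
  have := dimv_sum_cap (ell k :&: C i.+1) H.
  have -> : (ell k :&: C i.+1 :&: H = ell k :&: H)%VS.
    by rewrite -capvA; congr (_ :&: _)%VS; apply/capv_idPr.
  have := dimvS (_ : (ell k :&: C i.+1 + H <= C i.+1)%VS).
  rewrite subv_add capvSr HG => /(_ isT).
  move: g2 dG lo up; rewrite /gain -!/(meet_dim _ _) n1; lia.
have : 1 / 2 <= \sum_(j | j \notin ones) (meet_dim H j - meet_dim (C i) j)%N%:R * x 0 j.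
  rewrite (bigD1 k) /=; last by apply: contraL kE => /dis.
  rewrite ler_wpDr ?sumr_ge0 // => [j _|]; first by rewrite mulr_ge0.
  by rewrite frac_half // ler_peMl ?ler1n //; lra.
move=> h1; rewrite (eq_bigr (fun j => (gain C i j)%:R)); last first.
  by move=> j /dis/negbTE ->; rewrite mul0r subr0 mulr1.
rewrite -natr_sum => h2.
have : (\dim H)%:R <= (\dim (C i) + \sum_(j in ones) gain C i j)%:R :> R.
  by rewrite ler_nat.
rewrite natrD; lra.
Qed.

(** By [independent_step] each step of the chain, and the last one up to the full
    space, contributes its full gain to the dimension of the sum of the planes.
    At the last step fractional planes gain nothing, being contained in the top
    of the chain. *)
Lemma rigid_independent (M : {set 'I_m}) : (M \subset ones :|: fracs)%SET ->
  (forall i : 'I_r, (\sum_(k in M | k \in fracs) gain C i k <= 1)%N) ->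
  independent_planes M.
Proof.
move=> sM gM.
have collect F G : tight x F -> (F <= G)%VS ->
    (\sum_(k in M | k \in fracs) (meet_dim G k - meet_dim F k) <= 1)%N ->
    (\sum_(k in M) (meet_dim G k - meet_dim F k) + \dim (\sum_(k in M) (ell k :&: F))
      <= \dim (\sum_(k in M) (ell k :&: G)))%N.
  move=> tF FG g1; have := independent_step sM tF FG g1.
  have := dimv_sum_cap F (\sum_(k in M) (ell k :&: G)).
  have : (\dim (\sum_(k in M) (ell k :&: F))
            <= \dim (F :&: \sum_(k in M) (ell k :&: G)))%N.
    rewrite dimvS // subv_cap; apply/andP; split; apply/subv_sumP => k kM.
      exact: capvSr.
    by apply: subv_trans (capvS (subvv _) FG) _; apply: (sumv_sup k).
  lia.
have chain j : (j <= r)%N ->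
    (\sum_(k in M) meet_dim (C j) k <= \dim (\sum_(k in M) (ell k :&: C j)))%N.
  elim: j => [|j IH] jr.
    by rewrite big1 // => k _; rewrite chain0 meet_dim0.
  have := collect _ _ (chain_tight j) (chain_mono j) (gM (Ordinal jr)).
  have := IH (ltnW jr).
  have : (\sum_(k in M) meet_dim (C j.+1) k =
     \sum_(k in M) (meet_dim (C j.+1) k - meet_dim (C j) k) + \sum_(k in M) meet_dim (C j) k)%N.
    by rewrite -big_split; apply: eq_bigr => k _ /=; rewrite subnK ?meet_dim_mono.
  lia.
have h := chain r (leqnn r).
have h' : (\sum_(k in M) (meet_dim fullv k - meet_dim (C r) k)
    + \dim (\sum_(k in M) (ell k :&: C r)) <= \dim (\sum_(k in M) ell k))%N.
  rewrite [leqRHS](_ : _ = \dim (\sum_(k in M) (ell k :&: fullv))).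
    apply: collect (chain_tight r) (subvf _) _.
    rewrite big1 // => k /andP[_ /frac_in_top ->].
    by rewrite meet_dim_sub ?subvf.
  by congr (\dim _); apply: eq_bigr => k _; rewrite capvf.
apply/eqP; rewrite eqn_leq; apply/andP; split.
  apply: leq_trans (dimv_leq_sum _ _ _) _.
  rewrite (eq_bigr (fun=> 2%N)) => [|k _]; last exact: dim_ell.
  by rewrite sum_nat_const muln2 addnn.
apply: leq_trans h'; apply: leq_trans (leq_add (leqnn _) h).
rewrite -big_split /= (eq_bigr (fun=> 2%N)) => [|k _].
  by rewrite sum_nat_const muln2 addnn.
by rewrite subnK ?meet_dim_mono ?subvf // meet_dim_sub ?subvf.
Qed.

(** Two fractional edges conflict when they share a node.  As nodes have degree 2
    and edges two ends, an edge conflicts with at most two others. *)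
Lemma rigid_coloring : exists col : 'I_m -> 'I_3, forall c : 'I_3,
  forall i : 'I_r, (\sum_(k in fracs | col k == c) gain C i k <= 1)%N.
Proof.
pose conflict (j k : 'I_m) := [exists i : 'I_r, (0 < gain C i j)%N && (0 < gain C i k)%N].
have [||col colP] := @greedy_3coloring _ conflict fracs.
- by move=> j k; apply: eq_existsb => i; rewrite andbC.
- move=> k kE.
  pose nb (i : 'I_r) := finset (fun j => [&& j \in fracs, j != k & (0 < gain C i j)%N]).
  have le1 : (#|[pred j in fracs | (j != k) && conflict k j]|
      <= #|(\bigcup_(i : 'I_r | (0 < gain C i k)%N) nb i)%SET|)%N.
    apply: subset_leq_card; apply/fintype.subsetP => j; rewrite inE.
    case/and3P => jE jk /existsP[i /andP[gk gj]].
    by apply/finset.bigcupP; exists i => //; rewrite inE jE jk.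
  have le2 : (#|(\bigcup_(i : 'I_r | (0 < gain C i k)%N) nb i)%SET|
      <= \sum_(i < r | (0 < gain C i k)%N) #|nb i|)%N.
    elim/big_rec2: _ => [|i n A _ le]; first by rewrite cards0.
    by apply: leq_trans (leq_card_setU _ _) _; rewrite leq_add2l.
  apply: leq_trans le1 (leq_trans le2 _).
  rewrite -(frac_in_top kE) -sum_gain.
  rewrite [leqRHS](bigID (fun i : 'I_r => (0 < gain C i k)%N)) /=.
  apply: leq_trans (leq_addr _ _); apply: leq_sum => i gk.
  have di : (0 < deg i)%N by rewrite /deg (bigD1 k) //=; apply: ltn_addr.
  have : (#|nb i| <= \sum_(j in fracs | j != k) gain C i j)%N.
    rewrite -sum1_card (eq_bigl (fun j => ((j \in fracs) && (j != k)) && (0 < gain C i j)%N)).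
      rewrite big_mkcondr; apply: leq_sum => j _; by case: ifP.
    by move=> j; rewrite inE andbA.
  move=> nbS; apply: leq_trans nbS _.
  have := deg2 di; rewrite /deg (bigD1 k) //= => dk.
  by rewrite -(leq_add2l (gain C i k)) dk; move: gk; lia.
exists col => c i.
have [[k /and3P[kE /eqP kc gk]]|none] := pselect (exists k, [&& k \in fracs, col k == c & (0 < gain C i k)%N]).
  rewrite (bigD1 k) ?kE ?kc ?eqxx //= big1 ?addn0 ?no_loop // => j.
  case/andP => /andP[jE /eqP jc] jk; apply/eqP; rewrite -leqn0 leqNgt.
  apply/negP => gj; have := colP _ _ jE kE jk; rewrite jc kc eqxx => /(_ _)/negP.
  by case => //; apply/existsP; exists i; rewrite gj.
rewrite big1 // => k /andP[kE kc]; apply/eqP; rewrite -leqn0 leqNgt; apply/negP => gk.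
by apply: none; exists k; rewrite kE kc.
Qed.

(** Each colour class is taken with weight 2/9 together with the planes of value 1
    and with weight 1/9 alone: a plane of value 1 receives 3 * 2/9, and a plane of
    value 1/2, which has one colour, receives 2/9 + 1/9. *)
Lemma rigid_two_thirds :
  conv [set \row_k (k \in M)%:R | M in independent_planes] ((2 / 3) *: x).
Proof.
have [col colP] := rigid_coloring.
pose part c : {set 'I_m} := finset (fun k => (k \in fracs) && (col k == c)).
have dis k : k \in ones -> k \in fracs = false.
  by rewrite !inE => /eqP ->; rewrite ltxx andbF.
have gpart (A : {set 'I_m}) c (i : 'I_r) : (A \subset ones)%SET ->
    (\sum_(k in A :|: part c | k \in fracs) gain C i k <= 1)%N.
  move=> /fintype.subsetP sA.
  rewrite (eq_bigl (fun k => (k \in fracs) && (col k == c))) ?colP // => k.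
  rewrite finset.in_setU [k \in part c]inE andbC.
  have [kA|_] := boolP (k \in A); first by rewrite dis ?sA.
  by case: (k \in fracs); rewrite ?andbF ?andbT.
have indep (A : {set 'I_m}) c : (A \subset ones)%SET ->
    independent_planes (A :|: part c)%SET.
  move=> sA; apply: rigid_independent => [|i]; last exact: gpart.
  rewrite finset.subUset (fintype.subset_trans sA) ?finset.subsetUl //=.
  apply/fintype.subsetP => k; rewrite inE => /andP[kE _].
  by rewrite finset.in_setU kE orbT.
apply: conv_idem.
exists 3%N, (fun=> 1 / 3), (fun c => (2 / 3) *: (\row_k (k \in (ones :|: part c)%SET)%:R)
   + (1 - 2 / 3) *: (\row_k (k \in (finset.set0 :|: part c)%SET)%:R)); split.
- by move=> _; lra.
- by rewrite sumr_const card_ord; lra.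
- move=> c; apply: conv_segment; first by lra.
    by apply: subset_conv; exists (ones :|: part c)%SET => //; apply: indep.
  apply: subset_conv; exists (finset.set0 :|: part c)%SET => //; apply: indep.
  exact: finset.sub0set.
apply/rowP => k; rewrite !mxE summxE.
under eq_bigr do rewrite !mxE finset.set0U finset.in_setU.
have [kE|kE] := boolP (k \in fracs).
  have kN : k \in ones = false by apply: contraTF kE => /dis ->.
  rewrite frac_half // (bigD1 (col k)) //= kN big1 ?addr0 => [|c nc].
    rewrite [k \in part _]inE kE eqxx /=; lra.
  rewrite [k \in part _]inE kE eq_sym (negbTE nc) /=; lra.
rewrite (eq_bigr (fun=> 1 / 3 * (2 / 3 * (k \in ones)%:R))) => [|c _]; last first.
  rewrite [k \in part _]inE (negbTE kE) /=.
  by rewrite orbF mulr0 addr0.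
have -> : x 0 k = (k \in ones)%:R.
  rewrite inE; case: eqP => // /eqP n1.
  move: kE; rewrite inE; have := x_le1 k; have := x_ge0 k.
  by rewrite !le_eqVlt (negbTE n1) /= => /orP[/eqP <-|->] // ->.
rewrite sumr_const card_ord; lra.
Qed.

End RigidPoint.

Theorem two_thirds_matching x : fractional_matching x ->
  conv [set \row_k (k \in M)%:R | M in independent_planes] ((2 / 3) *: x).
Proof.
move=> /fractional_matching_rigid fx.
have : conv (dilate (2 / 3) [set z : 'rV[R]_m | fractional_matching z /\ rigid z])
          ((2 / 3) *: x) by apply: dilate_conv; exists x.
apply: conv_min => _ [z [fz rz] <-].
have [C [r sC]] := saturated_chain_exists fz.
exact: rigid_two_thirds fz rz sC.
Qed.

End FractionalMatching.

(** * Monomials of determinants of blow-ups *)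

Section WeightedDegree.
Variables (K : fieldType) (n : nat) (h : 'I_n -> nat).
Implicit Types (p q : {mpoly K[n]}).

Definition weight_le (c : nat) p : Prop :=
  {in msupp p, forall z : 'X_{1..n}, (\sum_s h s * z s <= c)%N}.

Lemma weight_le_mono c d p : (c <= d)%N -> weight_le c p -> weight_le d p.
Proof. by move=> cd pc z /pc /leq_trans; apply. Qed.

Lemma weight_le_sum (I : Type) (r : seq I) (P : pred I) (F : I -> {mpoly K[n]}) c :
  (forall i, P i -> weight_le c (F i)) -> weight_le c (\sum_(i <- r | P i) F i).
Proof.
move=> Fc; apply: big_ind => // [|p q pc qc].
  by move=> z; rewrite msupp0.
by move=> z /msuppD_le; rewrite mem_cat => /orP[/pc|/qc].
Qed.

Lemma weight_leN c p : weight_le c p -> weight_le c (- p).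
Proof. by move=> pc z; rewrite (perm_mem (msuppN p)) => /pc. Qed.

Lemma weight_leM c d p q :
  weight_le c p -> weight_le d q -> weight_le (c + d) (p * q).
Proof.
move=> pc qd z /msuppM_le /allpairsP[[z1 z2] /= [/pc z1c /qd z2d ->]].
rewrite (eq_bigr (fun s => h s * z1 s + h s * z2 s)%N); last first.
  by move=> s _; rewrite mnmDE mulnDr.
by rewrite big_split leq_add.
Qed.

Lemma weight_le_prod (I : Type) (r : seq I) (F : I -> {mpoly K[n]}) (c : I -> nat) :
  (forall i, weight_le (c i) (F i)) ->
  weight_le (\sum_(i <- r) c i) (\prod_(i <- r) F i).
Proof.
move=> Fc; elim/big_rec2: _ => [|i p d _ IH]; last exact: weight_leM.
by move=> z; rewrite msupp1 inE => /eqP ->; rewrite big1 // => s _; rewrite mnm0E muln0.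
Qed.

Lemma weight_leZX (a : K) s : weight_le (h s) (a *: 'X_s).
Proof.
move=> z /msuppZ_le; rewrite msuppX inE => /eqP ->.
rewrite (bigD1 s) //= mnm1E eqxx muln1 big1 ?addn0 // => t ts.
by rewrite mnm1E eq_sym (negbTE ts) muln0.
Qed.

(** In the Leibniz expansion every term uses each row and each column once. *)
Lemma weight_le_det N (B : 'M[{mpoly K[n]}]_N) (p q : 'I_N -> nat) :
  (forall a b, weight_le (p a + q b) (B a b)) ->
  weight_le (\sum_a p a + \sum_b q b) (\det B).
Proof.
move=> Bpq; apply: weight_le_sum => s _; rewrite mulr_sign.
suff wp : weight_le (\sum_a p a + \sum_b q b) (\prod_i B i (s i)).
  by case: ifP => _ //; apply: weight_leN.
rewrite [X in (_ + X)%N](reindex_inj (@perm_inj _ s)) /= -big_split.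
by apply: weight_le_prod => i; apply: Bpq.
Qed.

Lemma weight_le_det_equiv N (B : 'M[{mpoly K[n]}]_N) (P Q : 'M[K]_N)
    (p q : 'I_N -> nat) : P \in unitmx -> Q \in unitmx ->
  (forall a b, weight_le (p a + q b)
     ((map_mx (@mpolyC n K) P *m B *m map_mx (@mpolyC n K) Q) a b)) ->
  weight_le (\sum_a p a + \sum_b q b) (\det B).
Proof.
rewrite !unitmxE !unitfE => P0 Q0 /weight_le_det.
rewrite !det_mulmx !det_map_mx mulrC mulrA -mpolyCM mul_mpolyC => w z zB.
by apply: w; rewrite (perm_mem (msuppZ _ _)) ?mulf_neq0.
Qed.

End WeightedDegree.

Section BlowUp.
Variables (K : fieldType) (n m : nat).
Variables (ell : 'I_m -> {vspace 'cV[K]_n}) (u v : 'I_m -> 'cV[K]_n).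
Hypothesis basis_ell : forall k, basis_of (ell k) [:: u k; v k].
Implicit Types (F : {vspace 'cV[K]_n}).

Let dim_ell k : \dim (ell k) = 2%N.
Proof. by case/andP: (basis_ell k) => /eqP <- /eqnP ->. Qed.

(** Gaussian elimination of the rows [f] of a basis of [F]: after it, at most
    [dim F] rows are nonzero on [F]. *)
Lemma annihilating_rows l (f : 'I_l -> 'I_n) F :
  exists P : 'M[K]_l, exists p : 'I_l -> bool,
  [/\ P \in unitmx, (\sum_a p a <= \dim F)%N
    & forall a, ~~ p a -> forall w, w \in F -> (P *m rowsub f w) a 0 = 0].
Proof.
(* [invmx (col_ebase Phi)] brings [Phi] to echelon form, whose rows from index
   [\rank Phi] on are zero. *)
pose Phi : 'M[K]_(l, \dim F) := \matrix_(i, j) (vbasis F)`_j (f i) 0.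
exists (invmx (col_ebase Phi)), (fun a => (a < \rank Phi)%N); split.
- by rewrite unitmx_inv col_ebase_unit.
- apply: leq_trans (rank_leq_col Phi).
  rewrite -(big_mkcond (fun a : 'I_l => (a < \rank Phi)%N) (fun=> 1%N)).
  by rewrite -(big_ord_widen l (fun=> 1%N) (rank_leq_row Phi)) sum1_card card_ord.
- move=> a pa w wF.
  have -> : rowsub f w = Phi *m \col_j coord (vbasis F) j w.
    apply/colP => i; rewrite !mxE {1}(coord_vbasis wF) summxE.
    by apply: eq_bigr => j _; rewrite !mxE mulrC.
  rewrite -{2}(mulmx_ebase Phi) !mulmxA mulVmx ?col_ebase_unit // mul1mx.
  rewrite -mulmxA mxE big1 // => j _; rewrite !mxE.
  by rewrite (negbTE pa) andbF mul0r.
Qed.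

Lemma plane_entry l (f g : 'I_l -> 'I_n) (P Q : 'M[K]_l) k a b :
  (P *m mxsub f g (line_coef u v k) *m Q^T) a b =
  (P *m rowsub f (u k)) a 0 * (Q *m rowsub g (v k)) b 0
  - (P *m rowsub f (v k)) a 0 * (Q *m rowsub g (u k)) b 0.
Proof.
have -> : mxsub f g (line_coef u v k) =
    rowsub f (u k) *m (rowsub g (v k))^T - rowsub f (v k) *m (rowsub g (u k))^T.
  by apply/matrixP => i j; rewrite !mxE !big_ord1 !mxE.
rewrite mulmxBr mulmxBl !mulmxA -!(mulmxA _ (trmx _)) -!trmx_mul.
move: (P *m _) (Q *m _) (P *m _) (Q *m _) => x1 y1 x2 y2.
by rewrite !mxE !big_ord1 !mxE.
Qed.


(** The entry is the determinant of two linear forms on the plane [ell k], which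
    are therefore independent.  If one of them vanishes on [F] then [ell k] is not
    contained in [F]; if both do, then [ell k] does not meet [F], since two forms
    on a plane with a common zero are proportional. *)
Lemma plane_entry_bound l (f g : 'I_l -> 'I_n) (P Q : 'M[K]_l) F k a b (p q : bool) :
  (~~ p -> forall w, w \in F -> (P *m rowsub f w) a 0 = 0) ->
  (~~ q -> forall w, w \in F -> (Q *m rowsub g w) b 0 = 0) ->
  (P *m mxsub f g (line_coef u v k) *m Q^T) a b != 0 ->
  (meet_dim ell F k <= p + q)%N.
Proof.
rewrite plane_entry; pose alpha (w : 'cV[K]_n) := (P *m rowsub f w) a 0.
pose beta (w : 'cV[K]_n) := (Q *m rowsub g w) b 0.
rewrite -!/(alpha _) -!/(beta _) => pF qF; apply: contraNT; rewrite -ltnNge => pq.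
have lin (A : 'M[K]_l) (h : 'I_l -> 'I_n) c (s t : K) (x y : 'cV[K]_n) :
    (A *m rowsub h (s *: x + t *: y)) c 0 =
    s * (A *m rowsub h x) c 0 + t * (A *m rowsub h y) c 0.
  rewrite !mxE !mulr_sumr -big_split; apply: eq_bigr => i _ /=; rewrite !mxE; ring.
have uE : u k \in ell k by rewrite (basis_mem (basis_ell k)) // !inE eqxx.
have vE : v k \in ell k by rewrite (basis_mem (basis_ell k)) // !inE eqxx orbT.
have full : (1 < meet_dim ell F k)%N -> u k \in F /\ v k \in F.
  move=> d2; have /subvP sF : (ell k <= F)%VS.
    apply/capv_idPl/eqP; rewrite eqEdim capvSl /=.
    by rewrite dim_ell.
  by split; apply: sF.
case: p q pq pF qF => [] [] //= pq.
- by have := dimvS (capvSl (ell k) F); rewrite dim_ell leqNgt pq.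
- move=> _ /(_ isT) qF; have [uF vF] := full pq.
  by rewrite /beta !qF // !mulr0 subr0.
- move=> /(_ isT) pF _; have [uF vF] := full pq.
  by rewrite /alpha !pF // !mul0r subr0.
move=> /(_ isT) pF /(_ isT) qF.
have : (ell k :&: F)%VS != 0%VS by rewrite -dimv_eq0 -lt0n.
rewrite -vpick0; set w := vpick _ => w0.
have /memv_capP[wE wF] : w \in (ell k :&: F)%VS by apply: memv_pick.
have [s [t e]] : exists s t, w = s *: u k + t *: v k.
  move: wE; rewrite -(span_basis (basis_ell k)) span_cons span_seq1.
  by case/memv_addP => _ /vlineP[s ->] [_ /vlineP[t ->] ->]; exists s, t.
have := qF _ wF; have := pF _ wF; rewrite e !lin -!/(alpha _) -!/(beta _) => ea eb.
(* The form values on the vector [s u + t v] of [F] vanish, so the determinant is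
   annihilated by both [s] and [t]. *)
have es : s * (alpha (u k) * beta (v k) - alpha (v k) * beta (u k)) = 0.
  transitivity (beta (v k) * (s * alpha (u k) + t * alpha (v k))
    - alpha (v k) * (s * beta (u k) + t * beta (v k))); first by ring.
  by rewrite ea eb !mulr0 subr0.
have et : t * (alpha (u k) * beta (v k) - alpha (v k) * beta (u k)) = 0.
  transitivity (alpha (u k) * (s * beta (u k) + t * beta (v k))
    - beta (u k) * (s * alpha (u k) + t * alpha (v k))); first by ring.
  by rewrite ea eb !mulr0 subr0.
apply: contraR w0 => ne; rewrite e.
move/eqP: es; rewrite mulf_eq0 (negbTE ne) orbF => /eqP ->.
move/eqP: et; rewrite mulf_eq0 (negbTE ne) orbF => /eqP ->.
by rewrite !scale0r addr0.
Qed.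

Lemma sum_tens_index (l d : nat) (p : 'I_l -> nat) :
  (\sum_(c < l * d) p (mxtens_unindex c).1 = d * \sum_a p a)%N.
Proof.
transitivity (\sum_(c : 'I_l * 'I_d) p c.1)%N.
  rewrite (reindex (@mxtens_index l d)); last first.
    by exists (@mxtens_unindex l d) => x _; rewrite ?mxtens_indexK ?mxtens_unindexK.
  by apply: eq_bigr => c _; rewrite mxtens_indexK.
rewrite -(pair_bigA _ (fun (a : 'I_l) (_ : 'I_d) => p a)) big_distrr /=.
by apply: eq_bigr => a _; rewrite sum_nat_const card_ord.
Qed.

(** The row and column operations are tensored with the identity, so that weights
    are repeated [d] times and act on the coefficient matrices only. *)
Lemma blowup_weight (d l : nat) (f g : 'I_l -> 'I_n) F (z : 'X_{1..nblow m d}) :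
  z \in msupp (\det (blowup d (fun k => mxsub f g (line_coef u v k)))) ->
  (\sum_k meet_dim ell F k * (\sum_i \sum_j z (blowvar k i j)) <= d * (2 * \dim F))%N.
Proof.
have [P [p [Pu pF Pp]]] := annihilating_rows f F.
have [Q [q [Qu qF Qq]]] := annihilating_rows g F.
pose h (s : 'I_(nblow m d)) := meet_dim ell F (enum_val s).1.1.
move=> zB.
have -> : (\sum_k meet_dim ell F k * (\sum_i \sum_j z (blowvar k i j))
    = \sum_s h s * z s)%N.
  rewrite (reindex (@enum_rank ('I_m * 'I_d * 'I_d)%type)) /=; last first.
    by exists enum_val => x _; rewrite ?enum_rankK ?enum_valK.
  rewrite (eq_bigr (fun s : 'I_m * 'I_d * 'I_d =>
     meet_dim ell F s.1.1 * z (blowvar s.1.1 s.1.2 s.2))%N); last first.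
    by move=> [[k i] j] _; rewrite /h enum_rankK.
  rewrite -(pair_bigA _ (fun s j => meet_dim ell F s.1 * z (blowvar s.1 s.2 j))%N) /=.
  rewrite -(pair_bigA _ (fun k i => \sum_j meet_dim ell F k * z (blowvar k i j))%N) /=.
  apply: eq_bigr => k _; rewrite big_distrr; apply: eq_bigr => i _ /=.
  by rewrite big_distrr.
apply: (@leq_trans (\sum_(c < l * d) p (mxtens_unindex c).1
    + \sum_(c < l * d) q (mxtens_unindex c).1)); last first.
  rewrite (sum_tens_index d (fun a => p a : nat)) (sum_tens_index d (fun a => q a : nat)).
  by rewrite -mulnDr leq_mul2l mul2n -addnn leq_add ?orbT.
have unit_tens (A : 'M[K]_l) : A \in unitmx -> tensmx A (1%:M : 'M_d) \in unitmx.
  move=> Au; suff /mulmx1_unit[] : tensmx A 1%:M *m tensmx (invmx A) (1%:M : 'M_d) = 1%:M by [].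
  rewrite tensmx_mul mulmxV // mulmx1; apply/matrixP => c c'.
  case: (mxtens_indexP c) => x i; case: (mxtens_indexP c') => y j.
  rewrite tensmxE !mxE (can_eq (@mxtens_indexK _ _)) xpair_eqE.
  by case: (x == y); case: (i == j); rewrite ?mulr0 ?mul0r ?mulr1.
have := @weight_le_det_equiv _ _ h _ (blowup d (fun k => mxsub f g (line_coef u v k)))
  (tensmx P 1%:M) (tensmx Q^T 1%:M)
  (fun c => p (mxtens_unindex c).1) (fun c => q (mxtens_unindex c).1)
  (unit_tens _ Pu) (unit_tens _ _).
apply => //; first by rewrite unitmx_tr.
move=> c c'.
case: (mxtens_indexP c) => a i; case: (mxtens_indexP c') => b j.
rewrite !mxtens_indexK /= /blowup mulmx_sumr mulmx_suml summxE.
apply: weight_le_sum => k _.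
rewrite !map_mxT !map_mx1 !tensmx_mul mul1mx mulmx1 -!map_mxM tensmxE.
rewrite [map_mx _ _ _ _]mxE [generic_mx _ _ _ _ _]mxE.
rewrite mul_mpolyC.
have [->|ne] := eqVneq ((P *m mxsub f g (line_coef u v k) *m Q^T) a b) 0.
  by rewrite scale0r => y; rewrite msupp0.
apply: weight_le_mono (@weight_leZX _ _ h _ (blowvar k i j)).
rewrite /h enum_rankK /=; apply: plane_entry_bound ne; [exact: Pp|exact: Qq].
Qed.

Lemma proj_fractional (R : realType) (d l : nat) (f g : 'I_l -> 'I_n) (z : 'X_{1..nblow m d}) :
  (0 < d)%N ->
  z \in msupp (\det (blowup d (fun k => mxsub f g (line_coef u v k)))) ->
  fractional_matching ell (2^-1 *: proj R z).
Proof.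
move=> d0 zB; have dR : 0 < d%:R :> R by rewrite ltr0n.
have E k : (2^-1 *: proj R z) 0 k =
    (2 * d%:R)^-1 * (\sum_i \sum_j z (blowvar k i j))%N%:R :> R.
  rewrite !mxE invfM mulrA natr_sum; congr (_ * _).
  by apply: eq_bigr => i _; rewrite natr_sum.
split=> [k|F]; first by rewrite E mulr_ge0 // invr_ge0 mulr_ge0.
have := blowup_weight F zB; rewrite -(ler_nat R) => le.
rewrite /load (eq_bigr (fun k => (2 * d%:R)^-1 *
   (meet_dim ell F k * (\sum_i \sum_j z (blowvar k i j)))%N%:R)) => [|k _]; last first.
  by rewrite E natrM mulrCA.
rewrite -mulr_sumr -natr_sum mulrC ler_pdivrMr ?mulr_gt0 //.
suff -> : (\dim F)%:R * (2 * d%:R) = (d * (2 * \dim F))%N%:R :> R by [].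
by rewrite !natrM; ring.
Qed.

End BlowUp.

(** * Minors attached to independent sets of planes *)

Section Matchings.
Variables (K : fieldType) (n m : nat).
Variables (ell : 'I_m -> {vspace 'cV[K]_n}) (u v : 'I_m -> 'cV[K]_n).
Hypothesis basis_ell : forall k, basis_of (ell k) [:: u k; v k].

(** The substitution sending the indeterminates outside [M] to 0; it preserves the
    coefficients of monomials in the remaining ones. *)
Definition kept_vars (M : {set 'I_m}) : m.-tuple {mpoly K[m]} :=
  [tuple (if k \in M then 'X_k else 0) | k < m].

Lemma mcoeff_kept_vars (M : {set 'I_m}) (p : {mpoly K[m]}) (z : 'X_{1..m}) :
  (forall k, k \notin M -> z k = 0%N) -> (p \mPo kept_vars M)@_z = p@_z.
Proof.
move=> zM; rewrite comp_mpolyEX [in RHS](mpolyE p) !raddf_sum.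
apply: eq_bigr => y _ /=; rewrite !mcoeffZ.
congr (_ * _); rewrite comp_mpolyX mcoeffX.
have [yM|] := boolP [forall k, (k \notin M) ==> (y k == 0%N)].
  rewrite (eq_bigr (fun k => 'X_k ^+ y k)) => [|k _]; last first.
    rewrite tnth_mktuple; case: ifP => // kM.
    by have := forallP yM k; rewrite kM => /eqP ->; rewrite !expr0.
  by rewrite -mpolyXE_id mcoeffX.
case/forallPn => k; rewrite negb_imply => /andP[kM yk].
rewrite (bigD1 k) //= tnth_mktuple (negbTE kM) expr0n (negbTE yk) mul0r mcoeff0.
by case: eqP => // e; rewrite e zM // eqxx in yk.
Qed.

(** The order [p] is equal to [q] only up to a proof because it will be the
    cardinal of a set of rows. *)
Lemma det_sandwich p q (C : 'M[K]_(p, q)) (D : 'M[K]_(q, p)) (N : 'M[{mpoly K[m]}]_q) :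
  p = q -> row_full C -> row_free D ->
  exists2 c, c != 0 & \det (map_mx (@mpolyC m K) C *m N *m map_mx (@mpolyC m K) D)
     = c *: \det N.
Proof.
move=> e; move: C D; rewrite e {p e} => C D Cu Du; exists (\det C * \det D).
  by rewrite mulf_neq0 // -unitfE -unitmxE -?row_free_unit // -row_full_unit.
rewrite !det_mulmx !det_map_mx -mul_mpolyC mpolyCM; ring.
Qed.

Section IndependentSet.
Variable M : {set 'I_m}.
Hypothesis indM : independent_planes ell M.

Let U : 'M[K]_(n, #|M|) := \matrix_(i, a) u (enum_val a) i 0.
Let V : 'M[K]_(n, #|M|) := \matrix_(i, a) v (enum_val a) i 0.
Let B : 'M[K]_(n, #|M| + #|M|) := row_mx U V.
Let B' : 'M[K]_(#|M| + #|M|, n) := col_mx V^T (- U^T).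
Let X : 'M[{mpoly K[m]}]_#|M| := diag_mx (\row_a 'X_(enum_val a)).

Lemma planes_row_full : row_full B.
Proof.
(* The image of [B] contains all planes of [M], hence has full dimension, and
   [B] is injective. *)
pose psi := linfun (mulmx B : 'cV_(#|M| + #|M|) -> 'cV[K]_n).
have sub : (\sum_(k in M) ell k <= limg psi)%VS.
  apply/subv_sumP => k kM; rewrite -(span_basis (basis_ell k)).
  apply/span_subvP => w; rewrite !inE => /orP[]/eqP ->.
    have <- : psi (col_mx (delta_mx (enum_rank_in kM k) 0) 0) = u k.
      rewrite lfunE /= mul_row_col mulmx0 addr0 -colE.
      by apply/colP => i; rewrite !mxE enum_rankK_in.
    by rewrite memv_img ?memvf.
  have <- : psi (col_mx 0 (delta_mx (enum_rank_in kM k) 0)) = v k.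
    rewrite lfunE /= mul_row_col mulmx0 add0r -colE.
    by apply/colP => i; rewrite !mxE enum_rankK_in.
  by rewrite memv_img ?memvf.
have ker0 : lker psi = 0%VS.
  apply/eqP; rewrite -dimv_eq0; have := limg_ker_dim psi fullv.
  rewrite capfv dimvf dim_matrix ?mulr1; have := dimvS sub; rewrite indM => le e.
  by rewrite -leqn0 -(leq_add2r (\dim (limg psi))) e add0n.
rewrite /row_full -mxrank_tr -[_ == _]/(row_free B^T) -kermx_eq0; apply/rowV0P => w /sub_kermxP wB.
have : w^T \in lker psi.
  by rewrite memv_ker lfunE /= -[B]trmxK -trmx_mul wB trmx0.
by rewrite ker0 memv0 => /eqP e; rewrite -[w]trmxK e trmx0.
Qed.

(** Rows forming a basis are given in arbitrary order, whereas a minor lists its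
    rows increasingly; the row space does not depend on the order. *)
Lemma full_row_set : exists I : {set 'I_n},
  #|I| = (#|M| + #|M|)%N /\ row_full (rowsub (fun i : 'I_#|I| => enum_val i) B).
Proof.
pose phi := fullrankfun planes_row_full.
exists (phi @: [set: 'I_(#|M| + #|M|)])%SET; split.
  by rewrite card_imset ?cardsT ?card_ord //; apply: fullrankfun_inj.
rewrite -sub1mx.
apply: submx_trans (_ : (rowsub phi B <= _)%MS).
  by rewrite sub1mx fullrowsub_full.
apply/row_subP => i.
have iI : phi i \in (phi @: [set: 'I_(#|M| + #|M|)])%SET by apply: imset_f; rewrite inE.
have -> : row i (rowsub phi B) =
    row (enum_rank_in iI (phi i)) (rowsub (fun j => enum_val j) B).
  by apply/rowP => j; rewrite !mxE enum_rankK_in.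
exact: row_sub.
Qed.

(** [B'] is [B^T] multiplied by an invertible symplectic matrix. *)
Lemma colsub_free l (f : 'I_l -> 'I_n) : l = (#|M| + #|M|)%N ->
  row_full (rowsub f B) -> row_free (colsub f B').
Proof.
move=> el fB.
pose J : 'M[K]_(#|M| + #|M|) := block_mx 0 1%:M (- 1%:M) 0.
have Ju : J \in unitmx.
  have /mulmx1_unit[//] : J *m block_mx 0 (- 1%:M) 1%:M 0 = 1%:M.
  rewrite mulmx_block !mul0mx !mulmx0 !mulNmx !mulmxN !mulmx1 opprK !addr0 !add0r.
  by rewrite scalar_mx_block.
have JB : B' = J *m B^T.
  by rewrite tr_row_mx mul_block_col !mul0mx add0r addr0 mulNmx !mul1mx.
have -> : colsub f B' = J *m (rowsub f B)^T by rewrite JB mxsub_mul mxsub_id trmx_mxsub.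
have JF : row_full J by rewrite row_full_unit.
by rewrite /row_free (eqmxMfull _ JF) mxrank_tr.
Qed.

Lemma pencil_restricted :
  map_mx (comp_mpoly (kept_vars M)) (pencil (line_coef u v)) =
  map_mx (@mpolyC m K) B *m block_mx X 0 0 X *m map_mx (@mpolyC m K) B'.
Proof.
rewrite map_row_mx map_col_mx mul_row_block !mulmx0 addr0 add0r mul_row_col.
rewrite !mul_mx_diag; apply/matrixP => i j.
rewrite mxE summxE raddf_sum /= (bigID (mem M)) /= [X in _ + X]big1 ?addr0; last first.
  move=> k kM; rewrite !mxE rmorphM /= comp_mpolyXU -tnth_nth tnth_mktuple.
  by rewrite (negbTE kM) mul0r.
rewrite big_enum_val /= !mxE -big_split; apply: eq_bigr => a _.
rewrite !mxE rmorphM /= comp_mpolyXU -tnth_nth tnth_mktuple enum_valP comp_mpolyC.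
rewrite !big_ord1 !mxE mpolyCB mpolyCN !mpolyCM; ring.
Qed.

Definition double_indicator : 'X_{1..m} := [multinom (k \in M).*2 | k < m].

Lemma det_restricted : \det (block_mx X 0 0 X) = 'X_[double_indicator].
Proof.
rewrite det_ublock det_diag -expr2 -prodrXl mpolyXE_id.
rewrite (bigID (mem M)) /= [X in _ * X]big1 ?mulr1 => [|k /negbTE kM].
  rewrite [RHS]big_enum_val; apply: eq_bigr => a _.
  by rewrite !mxE mnmE enum_valP.
by rewrite mnmE kM expr0.
Qed.

Lemma independent_vertex (R : realType) :
  polytopeP R (line_coef u v) (2 *: \row_k (k \in M)%:R).
Proof.
apply: subset_conv; have [I [cI fI]] := full_row_set.
exists I, I, erefl; exists double_indicator; last first.
  apply/rowP => k; rewrite !mxE mnmE; case: (k \in M) => /=; rewrite ?mulr1 ?mulr0 //.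
rewrite mcoeff_msupp -(@mcoeff_kept_vars M); last first.
  by move=> k /negbTE kM; rewrite mnmE kM.
have -> A : @sqsub {mpoly K[m]} _ _ _ (erefl #|I|) A = mxsub enum_val enum_val A.
  by apply/matrixP => i j; rewrite !mxE cast_ord_id.
rewrite -[_ \mPo _]/(comp_mpoly (kept_vars M) _) -det_map_mx map_mxsub pencil_restricted.
rewrite mxsub_mul -mul_rowsub_mx -!map_mxsub.
have [c c0 ->] := det_sandwich (block_mx X 0 0 X) cI fI (colsub_free cI fI).
by rewrite det_restricted mcoeffZ mcoeffX eqxx mulr1.
Qed.

End IndependentSet.
End Matchings.

(** * The inclusion *)

Theorem theorem3p14 (R : realType) (K : fieldType) (n m : nat)
    (ell : 'I_m -> {vspace 'cV[K]_n}) (u v : 'I_m -> 'cV[K]_n)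
    (dim_ell : forall k, \dim (ell k) = 2%N)
    (basis_ell : forall k, basis_of (ell k) [:: u k; v k]) :
  dilate (2 / 3) (polytopeQ R (line_coef u v))
    `<=` polytopeP R (line_coef u v).
Proof.
apply: subset_trans (@dilate_conv _ _ _ _) _; apply: conv_min.
move=> _ [_ [d d0 [l _ [I [J [e [_ [z zB ->]]]]]]] <-].
have := proj_fractional basis_ell R d0 zB.
move=> /(two_thirds_matching dim_ell) fz.
(* The factor 1/2 makes the point a fractional matching; the factor 2 is the
   exponent of each indeterminate in the minors of independent sets. *)
have -> : (2 / 3) *: proj R z = 2 *: ((2 / 3) *: (2^-1 *: proj R z)).
  by rewrite !scalerA; congr (_ *: _); field.
have : conv (dilate 2 [set \row_k (k \in M)%:R | M in independent_planes ell])
    (2 *: ((2 / 3) *: (2^-1 *: proj R z))) by apply: dilate_conv; exists ((2 / 3) *: (2^-1 *: proj R z)).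
apply: conv_min => _ [_ [M indM <-] <-].
exact: independent_vertex.
Qed.
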